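(* Over any finite alphabet $A$, the temporal logics $\mathit{BThFacTL}$, $\mathit{BFacTL}$, $\mathit{NFacTL}$ and the two-variable logics $FO^2[<,\mathrm{thfac}]$ and $FO^2[<,\mathrm{betfac}]$ all define the same family of languages.
   Context: Let $A$ be a finite alphabet; words have positions $1,\dots,|w|$, $w(i)$ is the $i$-th letter. For $u\in A^+$ and $1\le i<j\le|w|$, an occurrence of $u$ strictly between $i$ and $j$ is a position $k$ with $i<k$, $k+|u|-1<j$ and $w(k)\cdots w(k+|u|-1)=u$. A factor threshold constraint is $\#u\sim c$ with $u\in A^+$, integer $c\ge0$, $\sim\in\{<,\le,>,\ge,=\}$; $(w,i,j)$ satisfies it if the number of occurrences of $u$ strictly between $i$ and $j$ is $\sim c$; boolean combinations are interpreted in the obvious way. Temporal formulas are built from atoms $a\in A$ by $\neg,\wedge,\vee$ and modalities $F_g\gamma$, $P_g\gamma$: $(w,i)\models a$ iff $w(i)=a$; $(w,i)\models F_g\gamma$ iff there is $j>i$ with $(w,i,j)$ satisfying $g$ and $(w,j)\models\gamma$; $(w,i)\models P_g\gamma$ iff there is $j<i$ with $(w,j,i)$ satisfying $g$ and $(w,j)\models\gamma$. A formula $\gamma$ defines the language of words $w$ with $(w,1)\models\gamma$. In $\mathit{BThFacTL}$ guards are arbitrary boolean combinations of factor threshold constraints. In $\mathit{BFacTL}$ guards are finite sets $R=\{u_1,\dots,u_p,\neg v_1,\dots,\neg v_r\}$ of words $u_i,v_j\in A^+$, standing for the constraint $\#u_1>0\wedge\dots\wedge\#u_p>0\wedge\#v_1=0\wedge\dots\wedge\#v_r=0$.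 In $\mathit{NFacTL}$ guards are of the form $\{\neg v\}$ with $v\in A^+$, standing for $\#v=0$. $FO^2[<,\mathrm{betfac}]$ is two-variable first-order logic (two reusable variables) with $<$, unary letter predicates, and binary predicates $\langle u\rangle(x,y)$ ($u\in A^+$) meaning there is an occurrence of $u$ strictly between $x$ and $y$; $FO^2[<,\mathrm{thfac}]$ has instead, for $u\in A^+$ and $k\ge0$, binary predicates meaning there are at least $k$ (possibly overlapping) occurrences of $u$ strictly between $x$ and $y$. These logics are interpreted in nonempty words.
   Formalization: The guards of NFacTL are {¬v} or the empty guard (plain F and P): with only guards {¬v}, ''the last letter is a'' is not definable once A has two letters, though it is in BFacTL. The alphabet A is assumed nonempty, as the empty alphabet has no temporal formulas. *)

(* Defs.v *)
From mathcomp Require Import all_boot.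

Set Implicit Arguments.
Unset Strict Implicit.
Unset Printing Implicit Defensive.

Definition neword (A : finType) := {u : seq A | u != [::]}.

Definition language (A : finType) := neword A -> Prop.

(* Positions are numbered from 0, so the initial position is 0 and the
   positions of w are the i < size w.  Differences of positions, hence all the
   notions below, are unaffected by this shift.  The count includes overlapping
   occurrences, and is 0 when j <= i. *)
Definition occ_between (A : finType) (w u : seq A) (i j : nat) : nat :=
  count (fun k => (k + size u <= j) && prefix u (drop k w))
        (index_iota i.+1 j).

Inductive tl (A G : Type) : Type :=
  | TAtom of A
  | TNot of tl A G
  | TAnd of tl A G & tl A G
  | TOr of tl A G & tl A G
  | TFut of G & tl A G
  | TPast of G & tl A G.

Definition guard_sem (A : finType) (G : Type) :=
  G -> seq A -> nat -> nat -> bool.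

Fixpoint tl_sat (A : finType) (G : Type) (gs : guard_sem A G) (w : seq A)
    (f : tl A G) (i : nat) {struct f} : bool :=
  match f with
  | TAtom a => onth w i == Some a
  | TNot f1 => ~~ tl_sat gs w f1 i
  | TAnd f1 f2 => tl_sat gs w f1 i && tl_sat gs w f2 i
  | TOr f1 f2 => tl_sat gs w f1 i || tl_sat gs w f2 i
  | TFut g f1 =>
      [exists j : 'I_(size w), [&& i < j, gs g w i j & tl_sat gs w f1 j]]
  | TPast g f1 =>
      [exists j : 'I_(size w), [&& j < i, gs g w j i & tl_sat gs w f1 j]]
  end.

Definition tl_definable (A : finType) (G : Type) (gs : guard_sem A G)
    (L : language A) : Prop :=
  exists f : tl A G, forall w : neword A, L w <-> tl_sat gs (val w) f 0.

Inductive cmp := CLt | CLe | CGt | CGe | CEq.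

Definition cmp_sem (c : cmp) (m n : nat) : bool :=
  match c with
  | CLt => m < n
  | CLe => m <= n
  | CGt => m > n
  | CGe => m >= n
  | CEq => m == n
  end.

Inductive thguard (A : finType) : Type :=
  | GConstr of neword A & cmp & nat
  | GNot of thguard A
  | GAnd of thguard A & thguard A
  | GOr of thguard A & thguard A.

Fixpoint thguard_sem (A : finType) (g : thguard A) (w : seq A) (i j : nat)
    {struct g} : bool :=
  match g with
  | GConstr u op c => cmp_sem op (occ_between w (val u) i j) c
  | GNot g1 => ~~ thguard_sem g1 w i j
  | GAnd g1 g2 => thguard_sem g1 w i j && thguard_sem g2 w i j
  | GOr g1 g2 => thguard_sem g1 w i j || thguard_sem g2 w i j
  end.

(* The finite set {u_1, ..., u_p, ~v_1, ..., ~v_r}, as the lists of its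
   positive and of its negated words. *)
Record bfguard (A : finType) : Type :=
  BFGuard { bf_pos : seq (neword A); bf_neg : seq (neword A) }.

Definition bfguard_sem (A : finType) (g : bfguard A) (w : seq A) (i j : nat)
    : bool :=
  all (fun u : neword A => 0 < occ_between w (val u) i j) (bf_pos g) &&
  all (fun v : neword A => occ_between w (val v) i j == 0) (bf_neg g).

(* Some v is the guard {~v}; None is the empty guard, i.e. the ordinary
   modalities F and P.  The latter cannot be dropped: if w1 contains every word
   of length at most n as a factor, a modality guarded by {~v} with size v <= n
   moves a bounded distance inside w1 ^ m, so without it no formula holds at
   the initial position of exactly the words that end with a given letter
   (as soon as there are two letters), although F_{} and F_{~v} define that
   language. *)
Definition nfguard (A : finType) : Type := option (neword A).

Definition nfguard_sem (A : finType) (g : nfguard A) (w : seq A) (i j : nat)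
    : bool :=
  if g is Some v then occ_between w (val v) i j == 0 else true.

Definition BThFacTL (A : finType) : language A -> Prop :=
  tl_definable (@thguard_sem A).

Definition BFacTL (A : finType) : language A -> Prop :=
  tl_definable (@bfguard_sem A).

Definition NFacTL (A : finType) : language A -> Prop :=
  tl_definable (@nfguard_sem A).

(* The two variables are named by the booleans; they may be requantified. *)
Inductive fo2 (A P : Type) : Type :=
  | FEq of bool & bool
  | FLt of bool & bool
  | FLetter of A & bool
  | FPred of P & bool & bool
  | FNot of fo2 A P
  | FAnd of fo2 A P & fo2 A P
  | FOr of fo2 A P & fo2 A P
  | FEx of bool & fo2 A P
  | FAll of bool & fo2 A P.

Fixpoint fo2_free (A P : Type) (x : bool) (f : fo2 A P) : bool :=
  match f with
  | FEq y z | FLt y z | FPred _ y z => (x == y) || (x == z)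
  | FLetter _ y => x == y
  | FNot f1 => fo2_free x f1
  | FAnd f1 f2 | FOr f1 f2 => fo2_free x f1 || fo2_free x f2
  | FEx y f1 | FAll y f1 => (x != y) && fo2_free x f1
  end.

Definition fo2_sentence (A P : Type) (f : fo2 A P) : bool :=
  [forall x : bool, ~~ fo2_free x f].

Definition upd (e : bool -> nat) (x : bool) (i : nat) : bool -> nat :=
  fun y => if y == x then i else e y.

Fixpoint fo2_sat (A : finType) (P : Type) (ps : guard_sem A P) (w : seq A)
    (f : fo2 A P) (e : bool -> nat) {struct f} : bool :=
  match f with
  | FEq x y => e x == e y
  | FLt x y => e x < e y
  | FLetter a x => onth w (e x) == Some a
  | FPred p x y => ps p w (e x) (e y)
  | FNot f1 => ~~ fo2_sat ps w f1 e
  | FAnd f1 f2 => fo2_sat ps w f1 e && fo2_sat ps w f2 e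
  | FOr f1 f2 => fo2_sat ps w f1 e || fo2_sat ps w f2 e
  | FEx x f1 => [exists i : 'I_(size w), fo2_sat ps w f1 (upd e x i)]
  | FAll x f1 => [forall i : 'I_(size w), fo2_sat ps w f1 (upd e x i)]
  end.

(* The truth value of a sentence does not depend on the valuation, here the
   one that sends both variables to the initial position. *)
Definition fo2_definable (A : finType) (P : Type) (ps : guard_sem A P)
    (L : language A) : Prop :=
  exists2 f : fo2 A P, fo2_sentence f &
    forall w : neword A, L w <-> fo2_sat ps (val w) f (fun=> 0).

Definition betfac_sem (A : finType) (u : neword A) (w : seq A) (i j : nat)
    : bool :=
  0 < occ_between w (val u) i j.

Definition thfac_sem (A : finType) (p : neword A * nat) (w : seq A)
    (i j : nat) : bool :=
  p.2 <= occ_between w (val p.1) i j.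

Definition FO2_betfac (A : finType) : language A -> Prop :=
  fo2_definable (@betfac_sem A).

Definition FO2_thfac (A : finType) : language A -> Prop :=
  fo2_definable (@thfac_sem A).

(* Main.v *)
Require Import Defs.
From mathcomp Require Import all_boot zify.

(** The point is that NFacTL is closed under the threshold modalities. With
guards {~b}, b a letter, it defines "next position", hence whether an occurrence
of u ends at a given position, and then the modality "some j > i with p, such
that no u ends strictly between i and j". A race argument extends this to "no
element of U ends strictly between i and j". The capped numbers of occurrences
of finitely many words form a state that changes boundedly many times as j
grows, and each change is reached by such a modality, so the truth of any
threshold guard can be tracked. Past modalities follow by reversing words. A
formula of FO2[<,thfac] in x and y is determined by finitely many NFacTL
properties of x and of y, the order of x and y and threshold guards, a form
preserved by quantification. The remaining inclusions are translations. *)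

Set Implicit Arguments.
Unset Strict Implicit.
Unset Printing Implicit Defensive.


(** * Occurrences of a word and their behaviour under reversal *)

Section Occurrences.
Variable A : finType.
Implicit Types (w : seq A) (u : neword A) (i j k : nat).

Definition starts u w k : bool := prefix (val u) (drop k w).
(** An occurrence of [u] has its last letter at [k]. The size test excludes the small [k] for which
    truncated subtraction would give the start 0. *)
Definition ends u w k : bool :=
  (size (val u) <= k.+1) && starts u w (k.+1 - size (val u)).

Lemma neword_size_gt0 u : 0 < size (val u).
Proof. by case: u => [[|a s]]. Qed.

Lemma starts_size u w k : starts u w k -> k + size (val u) <= size w.
Proof.
move=> st; have u_gt0 := neword_size_gt0 u.
have : size (val u) <= size (drop k w) := size_prefix st.
rewrite size_drop; lia.
Qed.

(** As [u] is nonempty, the requirement that an occurrence end before [j] can be absorbed into the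
    range of its starts. *)
Lemma occ_betweenE u w i j :
  occ_between w (val u) i j =
  count (starts u w) (index_iota i.+1 (j.+1 - size (val u))).
Proof.
have u_gt0 := neword_size_gt0 u.
rewrite /occ_between -!sum1_count [RHS](big_nat_widen _ _ j); last lia.
by apply: eq_bigl => k; rewrite andbC; congr (_ && _); lia.
Qed.

Lemma occ_between_gt0P u w i j :
  reflect (exists k, [/\ i < k, k + size (val u) <= j & starts u w k])
          (0 < occ_between w (val u) i j).
Proof.
rewrite occ_betweenE -has_count; apply: (iffP hasP) => -[k].
  by rewrite mem_index_iota => Hk st; exists k; split=> //; lia.
by move=> [ik kj st]; exists k => //; rewrite mem_index_iota; lia.
Qed.

Lemma occ_between_eq0P u w i j :
  reflect (forall k, i < k -> k + size (val u) <= j -> ~~ starts u w k)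
          (occ_between w (val u) i j == 0).
Proof.
rewrite eqn0Ngt; apply: (iffP negP) => [no k ik kj|no].
  by apply/negP => st; apply: no; apply/occ_between_gt0P; exists k.
by case/occ_between_gt0P=> k [ik kj st]; have := no k ik kj; rewrite st.
Qed.

Lemma occ_between_geq u w i j : j <= i -> occ_between w (val u) i j = 0.
Proof.
move=> ji; apply/eqP/occ_between_eq0P => k ik kj; exfalso; lia.
Qed.

(** Raising [j] by one admits a single new start, [j.+1 - size (val u)], that of an occurrence
    ending at [j]; the hypothesis puts this start after [i]. *)
Lemma occ_betweenS u w i j : i + size (val u) <= j ->
  occ_between w (val u) i j.+1 = occ_between w (val u) i j + ends u w j.
Proof.
move=> le_j; rewrite !occ_betweenE /ends.
have u_gt0 := neword_size_gt0 u.
rewrite (_ : j.+2 - _ = (j.+1 - size (val u)).+1); last lia.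
have le_i : i.+1 <= j.+1 - size (val u) by lia.
rewrite /index_iota (subSn le_i) -[(j.+1 - _ - _).+1]addn1 iotaD count_cat /= addn0 subnKC //.
by rewrite (_ : size (val u) <= j.+1); last lia.
Qed.

Lemma rev_neq_nil u : rev (val u) != [::].
Proof. by rewrite -size_eq0 size_rev size_eq0; case: u. Qed.

Definition rev_neword u : neword A := exist _ (rev (val u)) (rev_neq_nil u).

Lemma size_rev_neword u : size (val (rev_neword u)) = size (val u).
Proof. exact: size_rev. Qed.

Lemma starts_rev u w k : k + size (val u) <= size w ->
  starts (rev_neword u) (rev w) (size w - k - size (val u)) = starts u w k.
Proof.
move=> le_k; rewrite /starts /= drop_rev prefix_rev.
have sub_subK n l : k + l <= n -> n - (n - k - l) = k + l by lia.
rewrite sub_subK // suffixE prefixE size_take_min (minn_idPl le_k) addnK.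
by rewrite addnC take_drop.
Qed.

(** Reversal sends a start [k] to [size w - k - size (val u)], injectively on the occurrences
    counted. Applied to [rev w], this also gives the opposite inequality. *)
Lemma occ_between_rev_le u w i j : j < size w ->
  occ_between w (val u) i j <=
  occ_between (rev w) (rev (val u)) (size w - j.+1) (size w - i.+1).
Proof.
move=> jn; rewrite -[rev (val u)]/(val (rev_neword u)) !occ_betweenE -!size_filter.
set s := filter _ _.
rewrite -(size_map (fun k => size w - k - size (val u)) s).
have in_s k : k \in s -> [/\ i < k, k + size (val u) <= j & starts u w k].
  by rewrite mem_filter mem_index_iota => /andP[st Hk]; split=> //; lia.
apply: uniq_leq_size => [|k' /mapP[k /in_s[ik kj st]] ->].
  rewrite map_inj_in_uniq; first by rewrite filter_uniq // iota_uniq.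
  by move=> k l /in_s[ik kj _] /in_s[il lj _]; lia.
rewrite mem_filter mem_index_iota starts_rev ?st; last lia.
rewrite size_rev_neword; lia.
Qed.

Lemma occ_between_rev u w i j : i < size w -> j < size w ->
  occ_between (rev w) (rev (val u)) (size w - j.+1) (size w - i.+1) =
  occ_between w (val u) i j.
Proof.
move=> iw jw; apply/eqP; rewrite eqn_leq occ_between_rev_le // andbT.
have := @occ_between_rev_le (rev_neword u) (rev w) (size w - j.+1) (size w - i.+1).
rewrite size_rev /= !revK.
have -> : size w - (size w - j.+1).+1 = j by lia.
have -> : size w - (size w - i.+1).+1 = i by lia.
by apply; lia.
Qed.

End Occurrences.


(** * Modalities with semantic guards, and mirror images *)

Section Modalities.
Variable A : finType.
Implicit Types (w : seq A) (i j k : nat).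
Implicit Types (p q : seq A -> nat -> bool) (r : seq A -> nat -> nat -> bool).

Definition fut r p w i :=
  [exists j : 'I_(size w), [&& i < j, r w i j & p w j]].

Definition past r p w i :=
  [exists j : 'I_(size w), [&& j < i, r w j i & p w j]].

(** With this guard [fut] becomes the strict until modality: [p] at some later position, and [q]
    nowhere before it. *)
Definition avoids q w i j := all (fun k => ~~ q w k) (index_iota i.+1 j).

Definition mirror p w i := p (rev w) (size w - i.+1).

Lemma futP r p w i :
  reflect (exists j, [/\ i < j, j < size w, r w i j & p w j]) (fut r p w i).
Proof.
apply: (iffP existsP) => [[j /and3P[ij rij pj]]|[j [ij jn rij pj]]].
  by exists j; split.
by exists (Ordinal jn); apply/and3P; split.
Qed.

Lemma pastP r p w i :
  reflect (exists j, [/\ j < i, j < size w, r w j i & p w j]) (past r p w i).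
Proof.
apply: (iffP existsP) => [[j /and3P[ij rij pj]]|[j [ij jn rij pj]]].
  by exists j; split.
by exists (Ordinal jn); apply/and3P; split.
Qed.

Lemma avoidsP q w i j :
  reflect (forall k, i < k -> k < j -> ~~ q w k) (avoids q w i j).
Proof.
apply: (iffP allP) => [no k ik kj|no k].
  by apply: no; rewrite mem_index_iota ik.
by rewrite mem_index_iota => /andP[]; exact: no.
Qed.

Lemma eq_fut r r' p p' w i :
  (forall j, i < j < size w -> r w i j = r' w i j) ->
  (forall j, i < j < size w -> p w j = p' w j) ->
  fut r p w i = fut r' p' w i.
Proof.
move=> eq_r eq_p; apply: eq_existsb => j /=.
by case: (ltnP i j) => //= ij; rewrite eq_r ?eq_p ?ij ?ltn_ord.
Qed.

Lemma mirrorK p w i : i < size w -> mirror (mirror p) w i = p w i.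
Proof.
by move=> iw; rewrite /mirror revK size_rev (_ : _ - _ = i) //; lia.
Qed.

(** Reading the word backwards turns past into future, so that results about [fut] transfer to
    [past]. *)
Lemma past_mirror r r' p w i : i < size w ->
  (forall j, j < i -> r' (rev w) (size w - i.+1) (size w - j.+1) = r w j i) ->
  past r p w i = mirror (fut r' (mirror p)) w i.
Proof.
move=> iw rr'; apply/pastP/futP; rewrite size_rev => -[j [ji jw rji pj]].
  exists (size w - j.+1); split; try lia; first by rewrite rr'.
  by rewrite /mirror revK size_rev (_ : _ - _ = j) //; lia.
exists (size w - j.+1); split; try lia.
- rewrite -rr'; last lia.
  by rewrite (_ : _ - (_ - _).+1 = j) //; lia.
- by move: pj; rewrite /mirror revK size_rev.
Qed.

End Modalities.

(** * Properties of positions definable in NFacTL *)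

Section NFDefinable.
Variable A : finType.
Implicit Types (w : seq A) (u : neword A) (a : A) (i j k : nat).
Implicit Types (p q : seq A -> nat -> bool) (r : seq A -> nat -> nat -> bool).

(** Agreement is asked only at actual positions of the word, hence the side conditions [i < size w]
    below. *)
Definition nfdef p :=
  exists f : tl A (nfguard A), forall w i, i < size w ->
    tl_sat (@nfguard_sem A) w f i = p w i.

Lemma eq_nfdef p p' :
  nfdef p -> (forall w i, i < size w -> p w i = p' w i) -> nfdef p'.
Proof. by case=> f Hf Ep; exists f => w i iw; rewrite Hf ?Ep. Qed.

Lemma nfdef_atom a : nfdef (fun w i => onth w i == Some a).
Proof. by exists (TAtom _ a). Qed.

Lemma nfdef_not p : nfdef p -> nfdef (fun w i => ~~ p w i).
Proof. by case=> f Hf; exists (TNot f) => w i iw /=; rewrite Hf. Qed.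

Lemma nfdef_and p q : nfdef p -> nfdef q -> nfdef (fun w i => p w i && q w i).
Proof.
by case=> f Hf [g Hg]; exists (TAnd f g) => w i iw /=; rewrite Hf ?Hg.
Qed.

Lemma nfdef_or p q : nfdef p -> nfdef q -> nfdef (fun w i => p w i || q w i).
Proof.
by case=> f Hf [g Hg]; exists (TOr f g) => w i iw /=; rewrite Hf ?Hg.
Qed.

Lemma nfdef_fut_guard (g : nfguard A) p :
  nfdef p -> nfdef (fut (nfguard_sem g) p).
Proof.
case=> f Hf; exists (TFut g f) => w i iw /=.
by apply: eq_existsb => j; rewrite Hf.
Qed.

Definition rev_nfguard (g : nfguard A) : nfguard A := omap (@rev_neword A) g.

Lemma nfguard_sem_rev g w i j : i < size w -> j < size w ->
  nfguard_sem (rev_nfguard g) (rev w) (size w - j.+1) (size w - i.+1) =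
  nfguard_sem g w i j.
Proof. by case: g => //= u iw jw; rewrite occ_between_rev. Qed.

Lemma nfguard_semK g w i j : i < size w -> j < size w ->
  nfguard_sem g (rev w) (size w - j.+1) (size w - i.+1) =
  nfguard_sem (rev_nfguard g) w i j.
Proof.
move=> iw jw; rewrite -(nfguard_sem_rev _ iw jw) /rev_nfguard.
by case: g => //= u; rewrite revK.
Qed.

(** Reversal exchanges the future and past modalities and reverses the words in the guards. *)
Lemma nfdef_mirror p : nfdef p -> nfdef (mirror p).
Proof.
have onth_rev w i a : i < size w ->
    (onth (rev w) (size w - i.+1) == Some a) = (onth w i == Some a).
  move=> iw; rewrite !onthE map_rev nth_rev size_map; last lia.
  by rewrite (_ : _ - _ = i) //; lia.
(* The induction ranges over all [p], so that each subformula can be taken with its own semantics as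
   [p]. *)
case=> f; elim: f p => [a|f IHf|f IHf g IHg|f IHf g IHg|g f IHf|g f IHf] p Hp.
- apply: eq_nfdef (nfdef_atom a) _ => w i iw.
  by rewrite /mirror -Hp ?size_rev /= ?onth_rev //; lia.
- have := nfdef_not (IHf _ (fun _ _ _ => erefl)); move/eq_nfdef; apply=> w i iw.
  by rewrite /mirror -Hp ?size_rev //; lia.
- have := nfdef_and (IHf _ (fun _ _ _ => erefl)) (IHg _ (fun _ _ _ => erefl)).
  by move/eq_nfdef; apply=> w i iw; rewrite /mirror -Hp ?size_rev //; lia.
- have := nfdef_or (IHf _ (fun _ _ _ => erefl)) (IHg _ (fun _ _ _ => erefl)).
  by move/eq_nfdef; apply=> w i iw; rewrite /mirror -Hp ?size_rev //; lia.
- have [h Hh] := IHf _ (fun _ _ _ => erefl).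
  exists (TPast (rev_nfguard g) h) => w i iw.
  rewrite /mirror -Hp ?size_rev; last lia.
  transitivity (past (nfguard_sem (rev_nfguard g))
                  (mirror (fun v => tl_sat (@nfguard_sem A) v f)) w i).
    by apply: eq_existsb => j; rewrite -Hh.
  rewrite (past_mirror (r' := nfguard_sem g)) // => [|j ji].
    by apply: eq_existsb => j; rewrite mirrorK.
  by rewrite nfguard_semK //; lia.
- have [h Hh] := IHf _ (fun _ _ _ => erefl).
  exists (TFut (rev_nfguard g) h) => w i iw.
  rewrite /mirror -Hp ?size_rev; last lia.
  transitivity (past (nfguard_sem g) (fun v => tl_sat (@nfguard_sem A) v f)
                  (rev w) (size w - i.+1)); last by [].
  rewrite (past_mirror (r' := nfguard_sem (rev_nfguard g))) ?size_rev; first last.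
  + move=> j ji; have := @nfguard_sem_rev g (rev w) j (size w - i.+1).
    by rewrite size_rev; apply; lia.
  + lia.
  rewrite /mirror revK size_rev (_ : _ - _ = i); last lia.
  by apply: eq_existsb => j; congr [&& _, _ & _]; apply: Hh.
Qed.


End NFDefinable.


(** * Local properties and until modalities in NFacTL *)

Section Closure.
Variables (A : finType) (a0 : A).
Implicit Types (w : seq A) (u : neword A) (a : A) (i j k d : nat).
Implicit Types (p q : seq A -> nat -> bool) (r : seq A -> nat -> nat -> bool).

(** The syntax has no constants, so truth is excluded middle on a letter; this is why [a0] is
    fixed. *)
Lemma nfdef_const (b : bool) : nfdef (fun (_ : seq A) _ => b).
Proof.
have nfT : nfdef (fun (_ : seq A) _ => true).
  apply: eq_nfdef (nfdef_or (nfdef_atom a0) (nfdef_not (nfdef_atom a0))) _.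
  by move=> w i _; rewrite orbN.
by case: b => //; exact: eq_nfdef (nfdef_not nfT) _.
Qed.

Lemma nfdef_has (T : Type) (s : seq T) (p : T -> seq A -> nat -> bool) :
  (forall x, nfdef (p x)) -> nfdef (fun w i => has (fun x => p x w i) s).
Proof.
move=> Hp; elim: s => [|x s IHs] /=; first exact: nfdef_const.
exact: nfdef_or.
Qed.

Lemma nfdef_exists (T : finType) (p : T -> seq A -> nat -> bool) :
  (forall x, nfdef (p x)) -> nfdef (fun w i => [exists x, p x w i]).
Proof.
move=> Hp; apply: eq_nfdef (nfdef_has (enum T) Hp) _ => w i _.
apply/hasP/existsP => [[x _ px]|[x px]]; first by exists x.
by exists x; rewrite ?mem_enum.
Qed.

Lemma nfdef_if p q q' : nfdef p -> nfdef q -> nfdef q' ->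
  nfdef (fun w i => if p w i then q w i else q' w i).
Proof.
move=> Hp Hq Hq'.
apply: eq_nfdef (nfdef_or (nfdef_and Hp Hq) (nfdef_and (nfdef_not Hp) Hq')) _.
by move=> w i _; case: (p w i); rewrite ?orbF.
Qed.

(** Branching on the first property leaves [F], or [F] shifted by one, for the rest of the list; so
    the induction keeps [F] arbitrary. *)
Lemma nfdef_count (T : Type) (F : nat -> bool) (s : seq T)
    (p : T -> seq A -> nat -> bool) :
  (forall x, nfdef (p x)) -> nfdef (fun w i => F (count (fun x => p x w i) s)).
Proof.
move=> Hp; elim: s F => [|x s IHs] F /=; first exact: nfdef_const.
apply: eq_nfdef (nfdef_if (Hp x) (IHs (fun n => F n.+1)) (IHs F)) _.
by move=> w i _; case: (p x w i).
Qed.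

Definition letter_word a : neword A := exist _ [:: a] isT.

Lemma starts_letter a w k : starts (letter_word a) w k = (onth w k == Some a).
Proof.
rewrite /starts /= onthE; elim: w k => [|b w IHw] [|k] //=.
by rewrite prefix0s andbT eq_sym.
Qed.

Lemma avoid_letterP a w i j :
  reflect (forall k, i < k -> k < j -> onth w k != Some a)
          (nfguard_sem (Some (letter_word a)) w i j).
Proof.
apply: (iffP (occ_between_eq0P (letter_word a) w i j)) => no k ik kj.
  by rewrite -starts_letter; apply: no => //=; lia.
by rewrite starts_letter; apply: no => //; rewrite /= in kj; lia.
Qed.

(* The next letter is [a] iff, for every [b], some [a] is reached before
   passing any [b]. *)
Lemma nfdef_next_letter a : nfdef (fun w i => onth w i.+1 == Some a).
Proof.
have Hb b := nfdef_fut_guard (Some (letter_word b)) (nfdef_atom a).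
apply: eq_nfdef (nfdef_not (nfdef_exists (fun b => nfdef_not (Hb b)))) _ => w i iw.
rewrite negb_exists; apply/forallP/idP => [Ha|nxa b]; last first.
  rewrite negbK; apply/futP; exists i.+1; split=> //.
    by rewrite -onthTE (eqP nxa).
  by apply/avoid_letterP => k; lia.
have reach b : exists j, [/\ i < j, j < size w,
    forall k, i < k -> k < j -> onth w k != Some b & onth w j == Some a].
  have := Ha b; rewrite negbK => /futP[j [ij jw /avoid_letterP no ja]].
  by exists j.
have [j [ij jw _ _]] := reach a.
have : onth w i.+1 by rewrite onthTE; lia.
case def_c: (onth w i.+1) => [c|] // _.
(* Take for [b] the actual next letter [c]: reaching [a] only after [i.+1] would mean passing
   [c]. *)
have [l [il lw no la]] := reach c.
case: (ltngtP l i.+1) => [|lt_l|eq_l]; first lia.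
  by have := no i.+1 (ltnSn i) lt_l; rewrite def_c eqxx.
by rewrite -def_c -eq_l.
Qed.

(** If the next letter is [a], a modality whose guard avoids [a] cannot go past [i.+1], so it lands
    exactly there. *)
Lemma nfdef_next p : nfdef p -> nfdef (fun w i => (i.+1 < size w) && p w i.+1).
Proof.
move=> Hp.
have Ha a := nfdef_and (nfdef_next_letter a)
  (nfdef_fut_guard (Some (letter_word a)) (nfdef_and (nfdef_atom a) Hp)).
apply: eq_nfdef (nfdef_exists Ha) _ => w i iw.
apply/existsP/andP => [[a /andP[nxa /futP[j [ij jw]]]]|[iw' pi]].
  move=> /avoid_letterP no /andP[ja pj].
  case: (ltngtP j i.+1) => [|lt_j|<-]; [lia| |by []].
  by have := no i.+1 (ltnSn i) lt_j; rewrite nxa.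
have : onth w i.+1 by rewrite onthTE.
case def_a: (onth w i.+1) => [a|] // _.
exists a; rewrite eqxx /=; apply/futP; exists i.+1; split=> //.
  by apply/avoid_letterP => k; lia.
by rewrite def_a eqxx.
Qed.

Lemma nfdef_shift d p :
  nfdef p -> nfdef (fun w i => (i + d < size w) && p w (i + d)).
Proof.
elim: d p => [|d IHd] p Hp.
  by apply: eq_nfdef Hp _ => w i iw; rewrite addn0 iw.
apply: eq_nfdef (nfdef_next (IHd _ Hp)) _ => w i iw /=.
by rewrite addSnnS andbA; congr (_ && _); lia.
Qed.

(** Looking back is looking ahead in the reversed word. *)
Lemma nfdef_unshift d p :
  nfdef p -> nfdef (fun w i => (d <= i) && p w (i - d)).
Proof.
move=> Hp; apply: eq_nfdef (nfdef_mirror (nfdef_shift d (nfdef_mirror Hp))) _.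
move=> w i iw; rewrite /mirror revK !size_rev.
case: (leqP d i) => [le_d|lt_d]; last by rewrite [X in X && _](_ : _ = false) //; lia.
rewrite (_ : _ < _); last lia.
by congr p; lia.
Qed.

Lemma nfdef_prefix (s : seq A) : nfdef (fun w i => prefix s (drop i w)).
Proof.
elim: s => [|a s IHs].
  by apply: eq_nfdef (nfdef_const true) _ => w i _; rewrite prefix0s.
(* The case [s == [::]] is kept apart because the word may end at [i], where the test of the next
   position fails. *)
apply: (eq_nfdef (p := fun w i => (onth w i == Some a) &&
          ((s == [::]) || (i.+1 < size w) && prefix s (drop i.+1 w)))).
  exact: nfdef_and (nfdef_atom a) (nfdef_or (nfdef_const _) (nfdef_next IHs)).
move=> w i iw; rewrite (drop_nth a iw) prefix_cons onthE (nth_map a) //.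
congr (_ && _); first by rewrite eq_sym.
case: eqP => [->|/eqP s_neq0] /=; first by rewrite prefix0s.
case: ltnP => //= le_w; rewrite drop_oversize //.
by case: (s) s_neq0.
Qed.

Lemma nfdef_starts u d : nfdef (fun w i => starts u w (i + d)).
Proof.
apply: eq_nfdef (nfdef_shift d (nfdef_prefix (val u))) _ => w i iw.
case: ltnP => //= le_w; apply/esym/negbTE/negP => /starts_size.
have := neword_size_gt0 u; lia.
Qed.

Lemma nfdef_ends u : nfdef (ends u).
Proof.
have u_gt0 := neword_size_gt0 u.
apply: eq_nfdef (nfdef_unshift (size (val u)).-1 (nfdef_starts u 0)) _ => w i iw.
rewrite /ends addn0; congr (_ && _); first lia.
by congr starts; lia.
Qed.

(** At a fixed distance [d], the count involves only a fixed finite list of offsets from [i]. *)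
Lemma nfdef_occ_near u d (F : nat -> bool) :
  nfdef (fun w i => F (occ_between w (val u) i (i + d))).
Proof.
apply: eq_nfdef (nfdef_count F (index_iota 1 (d.+1 - size (val u))) (nfdef_starts u)) _.
move=> w i iw; congr F; rewrite occ_betweenE /index_iota -[i.+1]addn1 iotaDl count_map.
by congr (count _ (iota _ _)); lia.
Qed.

(** The until modality that forbids [q] is expressible in NFacTL; this is established below for
    particular [q]. *)
Definition closed_until q := forall p, nfdef p -> nfdef (fut (avoids q) p).

Lemma closed_until_false : closed_until (fun _ _ => false).
Proof.
move=> p /(nfdef_fut_guard None) /eq_nfdef; apply=> w i iw.
by apply: eq_fut => // j _; apply/esym/avoidsP.
Qed.

Lemma eq_closed_until q q' : closed_until q ->
  (forall w i, i < size w -> q w i = q' w i) -> closed_until q'.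
Proof.
move=> Hq eq_q p /Hq /eq_nfdef; apply=> w i iw; apply: eq_fut => // j /andP[_ jw].
by apply/avoidsP/avoidsP => no k ik kj; have := no k ik kj; rewrite eq_q //; lia.
Qed.

(* A race: until the first [q1] or [q2] position is until the first [q1]
   position if that one comes first, which is expressible using [q2] alone. *)
Lemma closed_until_or q1 q2 : nfdef q1 -> nfdef q2 ->
  closed_until q1 -> closed_until q2 -> closed_until (fun w i => q1 w i || q2 w i).
Proof.
move=> D1 D2 U1 U2 p Hp.
have Hq := nfdef_or D1 D2.
(* Three cases: some [q1] position comes no later than every [q2] position, or the converse, or
   neither property holds anywhere after [i]. *)
apply: eq_nfdef (nfdef_or (nfdef_and (U2 _ D1) (U1 _ Hp))
  (nfdef_or (nfdef_and (U1 _ D2) (U2 _ Hp))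
    (nfdef_and (nfdef_not (closed_until_false Hq)) (closed_until_false Hp)))) _.
move=> w i iw; apply/or3P/futP.
  case=> /andP[].
  (* Avoiding [q1] up to [j] forces [j <= l], and no [q2] position precedes [l]. *)
  - move=> /futP[l [il lw /avoidsP no2 q1l]] /futP[j [ij jw /avoidsP no1 pj]].
    exists j; split=> //; apply/avoidsP => k ik kj; rewrite negb_or no1 ?no2 //.
    by case: (ltnP l j) => [lj|]; [have := no1 l il lj; rewrite q1l|lia].
  - move=> /futP[l [il lw /avoidsP no1 q2l]] /futP[j [ij jw /avoidsP no2 pj]].
    exists j; split=> //; apply/avoidsP => k ik kj; rewrite negb_or no2 ?no1 //.
    by case: (ltnP l j) => [lj|]; [have := no2 l il lj; rewrite q2l|lia].
  - move=> /futP no /futP[j [ij jw _ pj]].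
    exists j; split=> //; apply/avoidsP => k ik kj; apply/negP => qk.
    by apply: no; exists k; split=> //; [lia|apply/avoidsP].
move=> [j [ij jw /avoidsP no pj]].
have [no1 no2] : (forall k, i < k -> k < j -> ~~ q1 w k) /\
                 (forall k, i < k -> k < j -> ~~ q2 w k).
  by split=> k ik kj; have := no k ik kj; rewrite negb_or => /andP[].
pose Q l := [&& i < l, l < size w & q1 w l || q2 w l].
case: (boolP (fut (avoids (fun _ _ => false)) (fun w i => q1 w i || q2 w i) w i)).
  move=> /futP[l0 [il0 lw0 _ ql0]].
  have exQ : exists l, Q l by exists l0; apply/and3P.
  case: (ex_minnP exQ) => l /and3P[il lw ql] minl.
  have noQ k : i < k -> k < l -> ~~ (q1 w k || q2 w k).
    move=> ik kl; apply/negP => qk; have := minl k; rewrite /Q ik qk andbT.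
    by move=> /(_ (ltn_trans kl lw)); rewrite leqNgt kl.
  case/orP: ql => ql; [apply: Or31|apply: Or32]; apply/andP; split; apply/futP.
  - by exists l; split=> //; apply/avoidsP => k ik /(noQ k ik); rewrite negb_or => /andP[].
  - by exists j; split=> //; apply/avoidsP.
  - by exists l; split=> //; apply/avoidsP => k ik /(noQ k ik); rewrite negb_or => /andP[].
  - by exists j; split=> //; apply/avoidsP.
move=> no_fut; apply: Or33; apply/andP; split=> //; apply/futP.
by exists j; split=> //; apply/avoidsP.
Qed.

(* An occurrence ending between [i] and [j] lies strictly between [i] and [j]
   unless it ends before [i + size u], a case that the letters around [i]
   decide. *)
Lemma closed_until_ends u : closed_until (ends u).
Proof.
move=> p Hp; set L := size (val u).
have u_gt0 : 0 < L := neword_size_gt0 u.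
have near_ends d : nfdef (fun w i => ends u w (i + d)).
  apply: eq_nfdef (nfdef_shift d (nfdef_ends u)) _ => w i iw.
  case: ltnP => //= le_w; apply/esym/negbTE/negP => /andP[le_L /starts_size].
  by rewrite -/L in le_L *; lia.
have near_free d : nfdef (fun w i => avoids (ends u) w i (i + d)).
  apply: eq_nfdef (nfdef_not (nfdef_has (index_iota 1 d) near_ends)) _ => w i iw.
  rewrite -all_predC; apply/allP/avoidsP => no k.
    move=> ik kd; have := no (k - i); rewrite mem_index_iota /= subnKC; last lia.
    by apply; lia.
  by rewrite mem_index_iota => Hk; apply: no; lia.
have near d : nfdef (fun w i => avoids (ends u) w i (i + d) &&
                              ((i + d < size w) && p w (i + d))).
  exact: nfdef_and (near_free d) (nfdef_shift d Hp).
(* Targets at distance below [L] are tested locally. For the others, [near_free L] excludes the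
   endings before [i + L], and the guard avoiding [u] those from [i + L] on. *)
apply: eq_nfdef (nfdef_or (nfdef_has (index_iota 1 L) near)
  (nfdef_and (near_free L) (nfdef_fut_guard (Some u) Hp))) _ => w i iw.
apply/orP/futP => [[/hasP[d]|/andP[/avoidsP free]]|[j [ij jw /avoidsP free pj]]].
- rewrite mem_index_iota => Hd /and3P[free dw pd].
  by exists (i + d); split=> //; lia.
- move=> /futP[j [ij jw /(occ_between_eq0P u) no pj]]; exists j; split=> //.
  apply/avoidsP => k ik kj; case: (ltnP k (i + L)) => [|le_k]; first exact: free.
  apply/negP => /andP[_]; apply/negP; apply: no; rewrite -/L; lia.
- case: (ltnP j (i + L)) => [lt_j|le_j]; [left|right].
    apply/hasP; exists (j - i); first by rewrite mem_index_iota; lia.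
    by rewrite subnKC ?jw ?pj ?andbT; [apply/avoidsP|lia].
  apply/andP; split; first by apply/avoidsP => k ik kL; apply: free; lia.
  apply/futP; exists j; split=> //; apply/(occ_between_eq0P u) => k ik kj.
  have := free (k + L).-1; rewrite /ends -/L.
  rewrite (_ : _ - L = k); last lia.
  by rewrite (_ : L <= _); [apply; lia|lia].
Qed.

End Closure.


(** * Finite-state runs whose state changes boundedly often *)

Section Runs.
Variables (A : finType) (a0 : A) (S : finType).
Variables (step : seq A -> nat -> S -> S) (rank : S -> nat).
Implicit Types (w : seq A) (i j k : nat) (s : S) (p : seq A -> nat -> bool).

Definition run w s i j := foldl (fun s k => step w k s) s (index_iota i.+1 j).

Definition moves s w k := step w k s != s.

Lemma run_geq w s i j : j <= i.+1 -> run w s i j = s.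
Proof.
by move=> le_j; rewrite /run /index_iota (_ : j - i.+1 = 0) //; lia.
Qed.

Lemma runS w s i j : i < j -> run w s i j.+1 = step w j (run w s i j).
Proof.
move=> ij; rewrite /run /index_iota (subSn ij) -[(j - _).+1]addn1 iotaD.
by rewrite foldl_cat /= subnKC.
Qed.

Lemma run_split w s i t j : i < t -> t < j ->
  run w s i j = run w (step w t (run w s i t)) t j.
Proof.
move=> it; elim: j => // j IHj; rewrite ltnS leq_eqVlt => /predU1P[<-|tj].
  by rewrite runS // [RHS]run_geq.
by rewrite !runS ?IHj //; lia.
Qed.

Lemma run_still w s i j : avoids (moves s) w i j -> run w s i j = s.
Proof.
elim: j => [|j IHj] /avoidsP still; first by rewrite run_geq.
case: (leqP j i) => [le_j|ij]; first by rewrite run_geq.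
rewrite runS // IHj; last by apply/avoidsP => k ik kj; apply: still; lia.
by apply/eqP; rewrite -[_ == _]negbK; exact: still.
Qed.

Hypothesis rank_step : forall w k s, moves s w k -> rank (step w k s) < rank s.
Hypothesis nfdef_step : forall s s', nfdef (fun w k => step w k s == s').
Hypothesis until_step : forall s, closed_until (moves s).

(* The state changes at most [rank s] times, and the first position where it
   changes can be reached by an until-modality. *)
Lemma nfdef_run (acc : pred S) s p :
  nfdef p -> nfdef (fut (fun w i j => acc (run w s i j)) p).
Proof.
move=> Hp; have [n] := ubnP (rank s); elim: n s => // n IHn s; rewrite ltnS => rk_s.
(* The first departure from [s] leads to [s'], and the run goes on from there. The rank test makes
   the induction hypothesis available for [s']. *)
pose change s' := fun w i => (rank s' < rank s) &&
  fut (avoids (moves s)) (fun w' t => (step w' t s == s') &&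
    fut (fun w i j => acc (run w s' i j)) p w' t) w i.
have nf_change s' : nfdef (change s').
  rewrite /change; case: ltnP => [lt_s'|_]; last exact: nfdef_const.
  by apply/until_step/nfdef_and => //; apply: IHn; lia.
apply: eq_nfdef (nfdef_or (nfdef_and (nfdef_const a0 (acc s)) (until_step s Hp))
  (nfdef_exists a0 nf_change)) _ => w i iw.
apply/orP/futP => [[/andP[acc_s]|/existsP[s' /andP[lt_s']]]|[j [ij jw acc_j pj]]].
- move=> /futP[j [ij jw still pj]]; exists j; split=> //.
  by rewrite run_still.
- move=> /futP[t [it tw still /andP[/eqP step_t /futP[j [tj jw acc_j pj]]]]].
  exists j; split=> //; first lia.
  by rewrite (run_split _ _ it tj) (run_still still) step_t.
- case: (boolP (avoids (moves s) w i j)) => [still|].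
    left; apply/andP; split; first by rewrite -(run_still still).
    by apply/futP; exists j.
  move=> /allPn[k]; rewrite mem_index_iota negbK => /andP[ik kj] move_k; right.
  have ex_t : exists t, (i < t) && moves s w t by exists k; rewrite ik.
  case: (ex_minnP ex_t) => t /andP[it move_t] min_t.
  have tj : t < j by have := min_t k; rewrite ik => /(_ move_k); lia.
  have still : avoids (moves s) w i t.
    apply/avoidsP => l il lt; apply/negP => move_l.
    by have := min_t l; rewrite il => /(_ move_l); lia.
  apply/existsP; exists (step w t s); rewrite /change rank_step //=.
  apply/futP; exists t; split=> //; first lia.
  rewrite eqxx; apply/futP; exists j; split=> //.
  by move: acc_j; rewrite (run_split _ _ it tj) (run_still still).
Qed.

End Runs.

(* [mon_val w i j] summarizes the factor of [w] strictly between [i] and [j].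
   It is updated by the letters up to position [j] alone only once
   [i + mon_delay <= j]: before that, some of these letters precede [i]. *)
Record monitor (A : finType) (r : seq A -> nat -> nat -> bool) := Monitor {
  mon_state : finType;
  mon_rank : mon_state -> nat;
  mon_step : seq A -> nat -> mon_state -> mon_state;
  mon_val : seq A -> nat -> nat -> mon_state;
  mon_acc : pred mon_state;
  mon_delay : nat;
  mon_rank_step : forall w k s, moves mon_step s w k ->
    mon_rank (mon_step w k s) < mon_rank s;
  mon_nfdef_step : forall s s', nfdef (fun w k => mon_step w k s == s');
  mon_until_step : forall s, closed_until (moves mon_step s);
  mon_nfdef_near : forall d s, nfdef (fun w i => mon_val w i (i + d) == s);
  mon_valS : forall w i j, i + mon_delay <= j ->
    mon_val w i j.+1 = mon_step w j (mon_val w i j);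
  mon_accE : forall w i j, r w i j = mon_acc (mon_val w i j)
}.

(** * Monitors for threshold guards *)

Section Monitors.
Variables (A : finType) (a0 : A).
Implicit Types (w : seq A) (u : neword A) (i j k d : nat).
Implicit Types (p : seq A -> nat -> bool) (r : seq A -> nat -> nat -> bool).

(** Targets within the delay [m] are tested one by one. For farther ones, a disjunction over the
    finitely many states guesses the value at [i + m.+1], and a run from that state takes over. *)
Lemma nfdef_monitor r p : monitor r -> nfdef p -> nfdef (fut r p).
Proof.
move=> M Hp; set m := mon_delay M; pose val := mon_val M.
(* The value at [(i + m).+1] accounts for the positions up to [i + m], and a run started at [i + m]
   first reads the position after it. *)
have val_run w i j : i + m < j ->
    val w i j = run (@mon_step _ _ M) w (val w i (i + m).+1) (i + m) j.
  elim: j => // j IHj; rewrite ltnS leq_eqVlt => /predU1P[<-|lt_j].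
    by rewrite run_geq.
  by rewrite runS // -IHj // [LHS]mon_valS //; exact: ltnW.
have near d : nfdef (fun w i => mon_acc (val w i (i + d)) &&
                                ((i + d < size w) && p w (i + d))).
  apply: nfdef_and (nfdef_shift a0 d Hp).
  apply: eq_nfdef (nfdef_has a0 (enum (@mon_acc _ _ M)) (@mon_nfdef_near _ _ M d)) _.
  move=> w i iw; apply/hasP/idP => [[s]|acc_v].
    by rewrite mem_enum /val => acc_s /eqP->.
  by exists (val w i (i + d)); rewrite ?mem_enum.
have far s : nfdef (fun w i => (val w i (i + m.+1) == s) && ((i + m < size w) &&
    fut (fun w i j => mon_acc (run (@mon_step _ _ M) w s i j)) p w (i + m))).
  apply: nfdef_and (@mon_nfdef_near _ _ M _ s) (nfdef_shift a0 m _).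
  apply: (nfdef_run a0 (rank := @mon_rank _ _ M)) => //.
  - exact: mon_rank_step.
  - exact: mon_nfdef_step.
  - exact: mon_until_step.
apply: eq_nfdef (nfdef_or (nfdef_has a0 (index_iota 1 m.+1) near)
                          (nfdef_exists a0 far)) _ => w i iw.
apply/orP/futP => [[/hasP[d]|/existsP[s /andP[/eqP val_s /andP[mw]]]]|].
- rewrite mem_index_iota => Hd /and3P[acc_d dw pd]; exists (i + d); split=> //.
    lia.
  by rewrite (mon_accE M).
- move=> /futP[j [ij jw acc_j pj]]; exists j; split=> //; first lia.
  by rewrite (mon_accE M) -/(val w i j) val_run // -addnS val_s.
- move=> [j [ij jw]]; rewrite (mon_accE M) -/(val w i j) => acc_j pj.
  case: (leqP j (i + m)) => [le_j|lt_j]; [left|right].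
    apply/hasP; exists (j - i); first by rewrite mem_index_iota; lia.
    by rewrite subnKC ?acc_j ?jw //; lia.
  apply/existsP; exists (val w i (i + m.+1)); rewrite eqxx (_ : i + m < _); last lia.
  by apply/futP; exists j; split=> //; rewrite addnS -val_run.
Qed.

(** A truncated count, put in a finite type to serve as a state. *)
Definition cap (c n : nat) : 'I_c.+1 := inord (minn c n).

Lemma val_cap c n : cap c n = minn c n :> nat.
Proof. by rewrite inordK // ltnS geq_minl. Qed.

(** The state is the count capped at [c.+1], since comparison with [c] does not separate larger
    counts. It grows only where [u] ends, and the delay [size (val u)] ensures that an occurrence
    ending at [j] starts after [i]. *)
Lemma monitor_constr u op c :
  monitor (fun w i j => cmp_sem op (occ_between w (val u) i j) c).
Proof.
pose step w k (s : 'I_c.+2) := if ends u w k then cap c.+1 s.+1 else s.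
pose st w i j := cap c.+1 (occ_between w (val u) i j).
have moveE s w k : moves step s w k = ends u w k && (s < c.+1).
  rewrite /moves /step; case: ends => //=; last by rewrite eqxx.
  rewrite -val_eqE /= val_cap; have := ltn_ord s; lia.
apply: (@Monitor _ _ _ (fun s : 'I_c.+2 => c.+1 - s) step st
  (fun s : 'I_c.+2 => cmp_sem op s c) (size (val u))).
- move=> w k s; rewrite moveE => /andP[ek lt_s]; rewrite /step ek val_cap; lia.
- move=> s s'; rewrite /step.
  apply: eq_nfdef (nfdef_if (nfdef_ends a0 u) (nfdef_const a0 (cap c.+1 s.+1 == s'))
    (nfdef_const a0 (s == s'))) _ => w k _; by case: ends.
- move=> s; case: (ltnP s c.+1) => lt_s.
    apply: eq_closed_until (closed_until_ends a0 u) _ => w k _.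
    by rewrite moveE lt_s andbT.
  (* A saturated state never moves. *)
  apply: eq_closed_until (@closed_until_false A) _ => w k _.
  by rewrite moveE ltnNge lt_s andbF.
- by move=> d s; exact: nfdef_occ_near a0 u d (fun n => cap c.+1 n == s).
- move=> w i j le_j; apply: val_inj; rewrite /st occ_betweenS // /step.
  case: ends; rewrite ?addn0 // /= !val_cap; lia.
- move=> w i j; rewrite /st val_cap; case: op => /=; lia.
Qed.

Lemma monitor_not r : monitor r -> monitor (fun w i j => ~~ r w i j).
Proof.
case=> S rank step st acc m H1 H2 H3 H4 H5 H6.
apply: (@Monitor _ _ S rank step st (fun s => ~~ acc s) m) => //.
by move=> w i j; rewrite H6.
Qed.

(** This is the product of the two monitors, with ranks added. It moves where either component
    moves, so its until modality comes from [closed_until_or]. *)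
Lemma monitor_op (op : bool -> bool -> bool) r1 r2 :
  monitor r1 -> monitor r2 -> monitor (fun w i j => op (r1 w i j) (r2 w i j)).
Proof.
case=> S1 rk1 step1 st1 acc1 m1 R1 D1 U1 N1 V1 E1.
case=> S2 rk2 step2 st2 acc2 m2 R2 D2 U2 N2 V2 E2.
pose step w k (s : S1 * S2) := (step1 w k s.1, step2 w k s.2).
have moveE s w k : moves step s w k = moves step1 s.1 w k || moves step2 s.2 w k.
  by case: s => s1 s2; rewrite /moves /step xpair_eqE negb_and.
have nf_move (S : finType) (st : seq A -> nat -> S -> S) (s : S) :
    (forall s s', nfdef (fun w k => st w k s == s')) -> nfdef (moves st s).
  by move=> /(_ s s) /nfdef_not.
have still (S : finType) (st : seq A -> nat -> S -> S) rk (s : S) w k :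
    (moves st s w k -> rk (st w k s) < rk s) -> rk (st w k s) <= rk s.
  rewrite /moves; case: eqP => [-> //|_ /(_ isT)]; exact: ltnW.
apply: (@Monitor _ _ _ (fun s => rk1 s.1 + rk2 s.2) step
  (fun w i j => (st1 w i j, st2 w i j)) (fun s => op (acc1 s.1) (acc2 s.2))
  (maxn m1 m2)).
- move=> w k s; rewrite moveE => mv.
  have le1 := still _ _ _ _ _ _ (R1 w k s.1).
  have le2 := still _ _ _ _ _ _ (R2 w k s.2).
  case/orP: mv => [/R1 lt1|/R2 lt2].
    exact: (leq_add lt1 le2).
  by rewrite -addnS; exact: (leq_add le1 lt2).
- move=> s s'; apply: eq_nfdef (nfdef_and (D1 s.1 s'.1) (D2 s.2 s'.2)) _.
  by case: s s' => [s1 s2] [s1' s2'] w k _; rewrite /step xpair_eqE.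
- move=> s; apply: eq_closed_until
    (closed_until_or (nf_move _ _ s.1 D1) (nf_move _ _ s.2 D2) (U1 _) (U2 _)) _.
  by move=> w k _; rewrite moveE.
- move=> d s; apply: eq_nfdef (nfdef_and (N1 d s.1) (N2 d s.2)) _.
  by case: s => [s1 s2] w i _; rewrite xpair_eqE.
- by move=> w i j le_j; rewrite /step /= V1 ?V2 //; lia.
- by move=> w i j; rewrite E1 E2.
Qed.

Lemma monitor_thguard (g : thguard A) : monitor (thguard_sem g).
Proof.
elim: g => [u op c|g Mg|g Mg h Mh|g Mg h Mh] /=.
- exact: monitor_constr.
- exact: monitor_not.
- exact: (monitor_op andb).
- exact: (monitor_op orb).
Qed.

Lemma nfdef_fut_thguard (g : thguard A) p : nfdef p -> nfdef (fut (thguard_sem g) p).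
Proof. by apply: nfdef_monitor; exact: monitor_thguard. Qed.

Fixpoint rev_thguard (g : thguard A) : thguard A :=
  match g with
  | GConstr u op c => GConstr (rev_neword u) op c
  | GNot g => GNot (rev_thguard g)
  | GAnd g h => GAnd (rev_thguard g) (rev_thguard h)
  | GOr g h => GOr (rev_thguard g) (rev_thguard h)
  end.

Lemma thguard_sem_rev g w i j : i < size w -> j < size w ->
  thguard_sem (rev_thguard g) (rev w) (size w - j.+1) (size w - i.+1) =
  thguard_sem g w i j.
Proof.
move=> iw jw; elim: g => [u op c|g IHg|g IHg h IHh|g IHg h IHh] /=.
- by rewrite occ_between_rev.
- by rewrite IHg.
- by rewrite IHg IHh.
- by rewrite IHg IHh.
Qed.

Lemma nfdef_past_thguard (g : thguard A) p :
  nfdef p -> nfdef (past (thguard_sem g) p).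
Proof.
move=> /nfdef_mirror /(nfdef_fut_thguard (rev_thguard g)) /nfdef_mirror /eq_nfdef.
apply=> w i iw; rewrite -(past_mirror (r := thguard_sem g)) // => j ji.
by rewrite thguard_sem_rev //; lia.
Qed.

End Monitors.


(** * Two-variable formulas as binary relations between positions *)

Section BinaryRelations.
Variables (A : finType) (a0 : A).
Implicit Types (w : seq A) (u : neword A) (i j k : nat).
Implicit Types (p : seq A -> nat -> bool) (r : seq A -> nat -> nat -> bool).

Lemma nfdef_tl_thguard (f : tl A (thguard A)) :
  nfdef (fun w i => tl_sat (@thguard_sem A) w f i).
Proof.
elim: f => [a|f IHf|f IHf g IHg|f IHf g IHg|g f IHf|g f IHf] /=.
- exact: nfdef_atom.
- exact: nfdef_not.
- exact: nfdef_and.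
- exact: nfdef_or.
- exact: (nfdef_fut_thguard a0 g IHf).
- exact: (nfdef_past_thguard a0 g IHf).
Qed.

(* The binary relations that reduce to a threshold guard once finitely many
   unary properties of either argument and their relative order are known. *)
Definition guarded r := exists (S : finType) (l m : seq A -> nat -> S)
    (glt ggt : S -> S -> thguard A) (geq : S -> S -> bool),
  [/\ forall s, nfdef (fun w i => l w i == s),
      forall s, nfdef (fun w i => m w i == s)
    & forall w i j, i < size w -> j < size w -> r w i j =
        if i < j then thguard_sem (glt (l w i) (m w j)) w i j
        else if j < i then thguard_sem (ggt (l w i) (m w j)) w j i
        else geq (l w i) (m w j)].

(** Guards have no constants either: a count is always [>= 0] and never [< 0]. *)
Definition const_guard (b : bool) : thguard A :=
  GConstr (letter_word a0) (if b then CGe else CLt) 0.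

Lemma const_guardE b w i j : thguard_sem (const_guard b) w i j = b.
Proof. by case: b. Qed.

Lemma eq_guarded r r' : guarded r ->
  (forall w i j, i < size w -> j < size w -> r w i j = r' w i j) -> guarded r'.
Proof.
move=> [S [l [m [glt [ggt [geq [Hl Hm Hr]]]]]]] eq_r.
by exists S, l, m, glt, ggt, geq; split=> // w i j iw jw; rewrite -eq_r ?Hr.
Qed.

Lemma guarded_not r : guarded r -> guarded (fun w i j => ~~ r w i j).
Proof.
move=> [S [l [m [glt [ggt [geq [Hl Hm Hr]]]]]]].
exists S, l, m, (fun s t => GNot (glt s t)), (fun s t => GNot (ggt s t)).
exists (fun s t => ~~ geq s t); split=> // w i j iw jw.
by rewrite Hr //; do 2!case: ifP => //.
Qed.

Lemma guarded_and r1 r2 :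
  guarded r1 -> guarded r2 -> guarded (fun w i j => r1 w i j && r2 w i j).
Proof.
move=> [S1 [l1 [m1 [glt1 [ggt1 [geq1 [Hl1 Hm1 Hr1]]]]]]].
move=> [S2 [l2 [m2 [glt2 [ggt2 [geq2 [Hl2 Hm2 Hr2]]]]]]].
have nf_pair (k1 : seq A -> nat -> S1) (k2 : seq A -> nat -> S2) :
    (forall s, nfdef (fun w i => k1 w i == s)) ->
    (forall s, nfdef (fun w i => k2 w i == s)) ->
    forall s, nfdef (fun w i => (k1 w i, k2 w i) == s).
  move=> D1 D2 [s1 s2]; apply: eq_nfdef (nfdef_and (D1 s1) (D2 s2)) _ => w i _.
  by rewrite xpair_eqE.
exists (S1 * S2)%type, (fun w i => (l1 w i, l2 w i)), (fun w i => (m1 w i, m2 w i)).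
exists (fun s t => GAnd (glt1 s.1 t.1) (glt2 s.2 t.2)).
exists (fun s t => GAnd (ggt1 s.1 t.1) (ggt2 s.2 t.2)).
exists (fun s t => geq1 s.1 t.1 && geq2 s.2 t.2).
split=> [||w i j iw jw]; [exact: nf_pair|exact: nf_pair|].
by rewrite Hr1 ?Hr2 //; do 2!case: ifP => //.
Qed.

Lemma guarded_or r1 r2 :
  guarded r1 -> guarded r2 -> guarded (fun w i j => r1 w i j || r2 w i j).
Proof.
move=> /guarded_not H1 /guarded_not H2.
apply: eq_guarded (guarded_not (guarded_and H1 H2)) _ => w i j _ _.
by rewrite negb_and !negbK.
Qed.

Lemma guarded_swap r : guarded r -> guarded (fun w i j => r w j i).
Proof.
move=> [S [l [m [glt [ggt [geq [Hl Hm Hr]]]]]]].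
exists S, m, l, (fun s t => ggt t s), (fun s t => glt t s), (fun s t => geq t s).
by split=> // w i j iw jw; rewrite Hr //; case: ltngtP.
Qed.

Lemma guarded_between (glt ggt : thguard A) (geq : bool) :
  guarded (fun w i j => if i < j then thguard_sem glt w i j
                        else if j < i then thguard_sem ggt w j i else geq).
Proof.
exists unit, (fun _ _ => tt), (fun _ _ => tt), (fun _ _ => glt), (fun _ _ => ggt).
by exists (fun _ _ => geq); split=> // -[]; exact: eq_nfdef (nfdef_const a0 true) _.
Qed.

Lemma guarded_lt : guarded (fun _ i j => i < j).
Proof.
apply: eq_guarded (guarded_between (const_guard true) (const_guard false) false) _.
by move=> w i j _ _; rewrite !const_guardE; case: ltngtP.
Qed.

Lemma guarded_eq : guarded (fun _ i j => i == j).
Proof.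
apply: eq_guarded (guarded_between (const_guard false) (const_guard false) true) _.
by move=> w i j _ _; rewrite !const_guardE; case: ltngtP.
Qed.

Lemma guarded_thfac (g : neword A * nat) : guarded (thfac_sem g).
Proof.
(* For [j <= i] the count is 0, so the predicate holds exactly when its threshold is 0. *)
apply: eq_guarded (guarded_between (GConstr g.1 CGe g.2)
                     (const_guard (g.2 == 0)) (g.2 == 0)) _.
move=> w i j _ _; rewrite const_guardE /thfac_sem.
by case: (ltnP i j) => // le_ji; rewrite occ_between_geq // leqn0 if_same.
Qed.

Lemma guarded_fst p : nfdef p -> guarded (fun w i _ => p w i).
Proof.
move=> Hp; exists bool, p, (fun _ _ => true), (fun s _ => const_guard s).
exists (fun s _ => const_guard s), (fun s _ => s).
split=> [[]|s|w i j iw jw].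
- by apply: eq_nfdef Hp _ => w i _; rewrite eqb_id.
- by apply: eq_nfdef (nfdef_not Hp) _ => w i _; rewrite eqbF_neg.
- exact: nfdef_const.
- by rewrite !const_guardE !if_same.
Qed.

(** Split by the label [s] of [i], the label [t] of [j], and their order. The labels fix the guard,
    and the order makes the quantifier a future modality, a past modality or a test at [i]. *)
Lemma nfdef_guarded_exists r : guarded r ->
  nfdef (fun w i => [exists j : 'I_(size w), r w i j]).
Proof.
move=> [S [l [m [glt [ggt [geq [Hl Hm Hr]]]]]]].
have Hst s t : nfdef (fun w i => (l w i == s) &&
    (fut (thguard_sem (glt s t)) (fun w j => m w j == t) w i ||
    (past (thguard_sem (ggt s t)) (fun w j => m w j == t) w i ||
    geq s t && (m w i == t)))).
  apply: nfdef_and (Hl s) (nfdef_or _ (nfdef_or _ _)).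
  - exact: nfdef_fut_thguard.
  - exact: nfdef_past_thguard.
  - exact: nfdef_and (nfdef_const a0 _) (Hm t).
apply: eq_nfdef (nfdef_exists a0 (fun s => nfdef_exists a0 (Hst s))) _ => w i iw.
apply/existsP/existsP => [[s /existsP[t /andP[/eqP ls /or3P]]]|[j]].
  case=> [/futP[j [ij jw gj /eqP mt]]|/pastP[j [ji jw gj /eqP mt]]|/andP[gj /eqP mt]].
  - by exists (Ordinal jw); rewrite Hr //= ls mt ij.
  - by exists (Ordinal jw); rewrite Hr //= ls mt ltnNge (ltnW ji) /= ji.
  - by exists (Ordinal iw); rewrite Hr //= ls mt ltnn.
rewrite Hr ?ltn_ord // => rij; exists (l w i); apply/existsP; exists (m w j).
rewrite eqxx /=; apply/or3P; case: (ltngtP i j) rij => [ij|ji|eq_ij] g_ij.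
- by apply: Or31; apply/futP; exists j; split.
- by apply: Or32; apply/pastP; exists j; split.
- by apply: Or33; rewrite g_ij -eq_ij eqxx.
Qed.

(** The diagonal is the existence of some [j] equal to [i] and related to it. *)
Lemma nfdef_guarded_diag r : guarded r -> nfdef (fun w i => r w i i).
Proof.
move=> Hr; apply: eq_nfdef (nfdef_guarded_exists (guarded_and guarded_eq Hr)) _.
move=> w i iw; apply/existsP/idP => [[j /andP[/eqP <-]] //|rii].
by exists (Ordinal iw); rewrite /= eqxx.
Qed.

Lemma eq_fo2_sat (P : Type) (ps : guard_sem A P) w (f : fo2 A P) e e' :
  e =1 e' -> fo2_sat ps w f e = fo2_sat ps w f e'.
Proof.
have upd_eq x i (d d' : bool -> nat) : d =1 d' -> upd d x i =1 upd d' x i.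
  by move=> eq_d y; rewrite /upd eq_d.
elim: f e e' => [x y|x y|a x|q x y|f IHf|f IHf g IHg|f IHf g IHg|x f IHf|x f IHf]
  e e' eq_e /=; rewrite ?eq_e //.
- by rewrite (IHf _ _ eq_e).
- by rewrite (IHf _ _ eq_e) (IHg _ _ eq_e).
- by rewrite (IHf _ _ eq_e) (IHg _ _ eq_e).
- by apply: eq_existsb => i; apply/IHf/upd_eq.
- by apply: eq_forallb => i; apply/IHf/upd_eq.
Qed.

Definition pair_env i j : bool -> nat := fun y => if y then j else i.

(** Atoms may repeat a variable, which calls for the diagonal. Quantifying one variable leaves a
    definable unary property of the other, which is again a guarded relation. *)
Lemma guarded_fo2 (f : fo2 A (neword A * nat)) :
  guarded (fun w i j => fo2_sat (@thfac_sem A) w f (pair_env i j)).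
Proof.
have guarded_pair r x y : guarded r ->
    guarded (fun w i j => r w (pair_env i j x) (pair_env i j y)).
  move=> Hr; have Hd := nfdef_guarded_diag Hr.
  case: x y => [] [] /=; last exact: guarded_fst.
  - exact: guarded_swap (guarded_fst Hd).
  - exact: guarded_swap.
  - exact: Hr.
have ex x r : guarded r -> guarded (fun w i j =>
    [exists k : 'I_(size w), if x then r w i k else r w k j]).
  case: x => Hr; first exact: guarded_fst (nfdef_guarded_exists Hr).
  exact: guarded_swap (guarded_fst (nfdef_guarded_exists (guarded_swap Hr))).
have updE g x w i j k : fo2_sat (@thfac_sem A) w g (upd (pair_env i j) x k) =
    if x then fo2_sat (@thfac_sem A) w g (pair_env i k)
    else fo2_sat (@thfac_sem A) w g (pair_env k j).
  by case: x; apply: eq_fo2_sat => -[].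
elim: f => [x y|x y|a x|q x y|f IHf|f IHf g IHg|f IHf g IHg|x f IHf|x f IHf] /=.
- exact: guarded_pair guarded_eq.
- exact: guarded_pair guarded_lt.
- exact: (guarded_pair _ x x (guarded_fst (nfdef_atom a))).
- exact: guarded_pair (guarded_thfac q).
- exact: guarded_not.
- exact: guarded_and.
- exact: guarded_or.
- apply: eq_guarded (ex x _ IHf) _ => w i j _ _.
  by apply: eq_existsb => k; rewrite updE.
- apply: eq_guarded (guarded_not (ex x _ (guarded_not IHf))) _ => w i j _ _.
  rewrite negb_exists; apply: eq_forallb => k; rewrite updE.
  by case: x; rewrite negbK.
Qed.

End BinaryRelations.

(** * Translations between the logics *)

Section Translations.
Variable A : finType.
Implicit Types (w : seq A) (L : language A).

Lemma nfdef_NFacTL p L : nfdef p ->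
  (forall w : neword A, L w <-> p (val w) 0) -> NFacTL L.
Proof.
by move=> [f Hf] HL; exists f => w; rewrite HL Hf // neword_size_gt0.
Qed.

Lemma BThFacTL_NFacTL (a0 : A) L : BThFacTL L -> NFacTL L.
Proof. by case=> f Hf; exact: nfdef_NFacTL (nfdef_tl_thguard a0 f) Hf. Qed.

Lemma FO2_thfac_NFacTL (a0 : A) L : FO2_thfac L -> NFacTL L.
Proof.
(* Both variables start at position 0, so the sentence is evaluated on the diagonal there. *)
case=> f _ Hf; apply: nfdef_NFacTL (nfdef_guarded_diag a0 (guarded_fo2 a0 f)) _ => w.
by rewrite Hf (@eq_fo2_sat _ _ _ _ _ _ (pair_env 0 0)) // => -[].
Qed.

Fixpoint map_tl (G H : Type) (h : G -> H) (f : tl A G) : tl A H :=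
  match f with
  | TAtom a => TAtom _ a
  | TNot f => TNot (map_tl h f)
  | TAnd f g => TAnd (map_tl h f) (map_tl h g)
  | TOr f g => TOr (map_tl h f) (map_tl h g)
  | TFut g f => TFut (h g) (map_tl h f)
  | TPast g f => TPast (h g) (map_tl h f)
  end.

Lemma tl_definable_map (G H : Type) (gs : guard_sem A G) (hs : guard_sem A H)
    (h : G -> H) L :
  (forall g w i j, hs (h g) w i j = gs g w i j) ->
  tl_definable gs L -> tl_definable hs L.
Proof.
move=> eq_h [f Hf]; exists (map_tl h f) => w; rewrite Hf.
suff -> : forall i, tl_sat hs (val w) (map_tl h f) i = tl_sat gs (val w) f i by [].
elim: {Hf}f => [a|f IHf|f IHf g IHg|f IHf g IHg|g f IHf|g f IHf] i //=.
- by rewrite IHf.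
- by rewrite IHf IHg.
- by rewrite IHf IHg.
- by apply: eq_existsb => j; rewrite eq_h IHf.
- by apply: eq_existsb => j; rewrite eq_h IHf.
Qed.

Lemma NFacTL_BFacTL L : NFacTL L -> BFacTL L.
Proof.
apply: (tl_definable_map (h := fun g => BFGuard [::] (seq_of_opt g))).
by case=> [v|] w i j; rewrite /bfguard_sem /= ?andbT.
Qed.

Lemma BFacTL_BThFacTL (a0 : A) L : BFacTL L -> BThFacTL L.
Proof.
pose conj (c : cmp) := foldr (fun u : neword A => GAnd (GConstr u c 0)).
apply: (tl_definable_map (h := fun g : bfguard A =>
  conj CGt (conj CEq (const_guard a0 true) (bf_neg g)) (bf_pos g))).
case=> us vs w i j; rewrite /bfguard_sem /=.
elim: us => [|u us IHus] /=; last by rewrite IHus andbA.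
by elim: vs => [|v vs IHvs] //=; rewrite IHvs.
Qed.

Fixpoint map_fo2 (P Q : Type) (h : P -> Q) (f : fo2 A P) : fo2 A Q :=
  match f with
  | FEq x y => FEq _ _ x y
  | FLt x y => FLt _ _ x y
  | FLetter a x => FLetter _ a x
  | FPred p x y => FPred _ (h p) x y
  | FNot f => FNot (map_fo2 h f)
  | FAnd f g => FAnd (map_fo2 h f) (map_fo2 h g)
  | FOr f g => FOr (map_fo2 h f) (map_fo2 h g)
  | FEx x f => FEx x (map_fo2 h f)
  | FAll x f => FAll x (map_fo2 h f)
  end.

Lemma fo2_free_map (P Q : Type) (h : P -> Q) x (f : fo2 A P) :
  fo2_free x (map_fo2 h f) = fo2_free x f.
Proof. by elim: f => //= [f -> g ->|f -> g ->|y f ->|y f ->]. Qed.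

Lemma FO2_betfac_thfac L : FO2_betfac L -> FO2_thfac L.
Proof.
case=> f sent_f Hf; exists (map_fo2 (fun u => (u, 1)) f).
  by rewrite /fo2_sentence; under eq_forallb => x do rewrite fo2_free_map.
move=> w; rewrite Hf; move: (fun=> 0) => e.
suff -> : fo2_sat (@thfac_sem A) (val w) (map_fo2 (fun u => (u, 1)) f) e =
          fo2_sat (@betfac_sem A) (val w) f e by [].
elim: f e {sent_f Hf} => //= [f IHf|f IHf g IHg|f IHf g IHg|x f IHf|x f IHf] e.
- by rewrite IHf.
- by rewrite IHf IHg.
- by rewrite IHf IHg.
- by apply: eq_existsb.
- by apply: eq_forallb.
Qed.

Definition fo2_nfguard (g : nfguard A) (x y : bool) : fo2 A (neword A) :=
  if g is Some v then FNot (FPred _ v x y) else FEq _ _ x x.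

(** The current position is held by [x]. A modality moves to the other variable, after which [x] is
    free for reuse, so two variables suffice. *)
Fixpoint fo2_tl (x : bool) (f : tl A (nfguard A)) : fo2 A (neword A) :=
  match f with
  | TAtom a => FLetter _ a x
  | TNot f => FNot (fo2_tl x f)
  | TAnd f g => FAnd (fo2_tl x f) (fo2_tl x g)
  | TOr f g => FOr (fo2_tl x f) (fo2_tl x g)
  | TFut g f => FEx (~~ x) (FAnd (FLt _ _ x (~~ x))
      (FAnd (fo2_nfguard g x (~~ x)) (fo2_tl (~~ x) f)))
  | TPast g f => FEx (~~ x) (FAnd (FLt _ _ (~~ x) x)
      (FAnd (fo2_nfguard g (~~ x) x) (fo2_tl (~~ x) f)))
  end.

Lemma fo2_free_tl x f : fo2_free (~~ x) (fo2_tl x f) = false.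
Proof.
elim: f => //= [a|f -> g ->|f -> g ->|g f _|g f _] //; rewrite ?eqxx //.
by case: x.
Qed.

Lemma fo2_sat_nfguard g x y w e :
  fo2_sat (@betfac_sem A) w (fo2_nfguard g x y) e = nfguard_sem g w (e x) (e y).
Proof. by case: g => [v|] /=; rewrite ?eqxx // eqn0Ngt. Qed.

Lemma fo2_sat_tl x f w e :
  fo2_sat (@betfac_sem A) w (fo2_tl x f) e = tl_sat (@nfguard_sem A) w f (e x).
Proof.
have upd_same d y i : upd d y i y = i by rewrite /upd eqxx.
have upd_other d y i : upd d (~~ y) i y = d y by rewrite /upd; case: y.
elim: f x e => //= [f IHf|f IHf g IHg|f IHf g IHg|g f IHf|g f IHf] x e.
- by rewrite IHf.
- by rewrite IHf IHg.
- by rewrite IHf IHg.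
- by apply: eq_existsb => j; rewrite fo2_sat_nfguard IHf upd_same upd_other.
- by apply: eq_existsb => j; rewrite fo2_sat_nfguard IHf upd_same upd_other.
Qed.

Lemma NFacTL_FO2_betfac L : NFacTL L -> FO2_betfac L.
Proof.
case=> f Hf.
(* The initial position is singled out as the one with no position before it. *)
exists (FEx false (FAnd (FNot (FEx true (FLt _ _ true false))) (fo2_tl false f))).
  by apply/forallP => -[] //=; rewrite (fo2_free_tl false).
move=> w; rewrite Hf /=; have w_gt0 := neword_size_gt0 w.
split=> [sat_f|/existsP[i /andP[/existsPn no_lt]]].
  apply/existsP; exists (Ordinal w_gt0); rewrite fo2_sat_tl sat_f andbT.
  by apply/existsPn.
by rewrite fo2_sat_tl /= /upd /=; have := no_lt (Ordinal w_gt0); case: (i : nat).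
Qed.

End Translations.

Theorem theorem4p5 (A : finType) (A_gt0 : 0 < #|A|) (L : language A) :
  [<-> BThFacTL L; BFacTL L; NFacTL L; FO2_thfac L; FO2_betfac L].
Proof.
have /card_gt0P[a0 _] := A_gt0.
(* Each implication of the cycle starts from, ends in or passes through NFacTL. *)
tfae.
- by move=> /(BThFacTL_NFacTL a0) /NFacTL_BFacTL.
- by move=> /(BFacTL_BThFacTL a0) /(BThFacTL_NFacTL a0).
- by move=> /NFacTL_FO2_betfac /FO2_betfac_thfac.
- by move=> /(FO2_thfac_NFacTL a0) /NFacTL_FO2_betfac.
- by move=> /FO2_betfac_thfac /(FO2_thfac_NFacTL a0) /NFacTL_BFacTL /(BFacTL_BThFacTL a0).
Qed.
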